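(* For every integer $n\ge 1$, $U(n)$ is odd if and only if $n\in\mathcal{J}$, and $U(n)$ is even if and only if $n\in\mathcal{K}$.
   Context: For $n\ge1$, the $n\times n$ Redheffer matrix has rows and columns indexed by $\{1,\dots,n\}$; its $(r,s)$ entry is $1$ if $s=1$ or if $r$ divides $s$, and is $0$ otherwise. $U(n)$ denotes the number of entries of this matrix equal to $1$ (the unit entries). $\mathbf{N}=\{0,1,2,\ldots\}$. For $n\in\mathbf{N}$, the offset of $n$ is $n-\lfloor\sqrt n\rfloor^2$. Set $\mathcal{J}=\{n\in\mathbf{N}: n-\lfloor\sqrt n\rfloor^2\text{ is even}\}$ and $\mathcal{K}=\{n\in\mathbf{N}: n-\lfloor\sqrt n\rfloor^2\text{ is odd}\}$. *)

(* Defs.v *)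
From mathcomp Require Import all_boot all_order all_algebra.
From Stdlib Require PeanoNat.

Set Implicit Arguments.
Unset Strict Implicit.
Unset Printing Implicit Defensive.

(* 'I_n is 0-based: the ordinals r and s stand for row r + 1 and column s + 1. *)
Definition redheffer (n : nat) : 'M[int]_n :=
  (\matrix_(r < n, s < n)
     if (s.+1 == 1)%N || (r.+1 %| s.+1)%N then 1 else 0)%R.

Definition U (n : nat) : nat :=
  #|[set rs : 'I_n * 'I_n | redheffer n rs.1 rs.2 == 1%R]|.

(* Nat.sqrt n is the floor of the square root of n (PeanoNat.Nat.sqrt_spec),
   so the truncated subtraction never truncates. *)
Definition offset (n : nat) : nat := n - Nat.sqrt n ^ 2.

Definition calJ : {pred nat} := [pred n | ~~ odd (offset n)].

Definition calK : {pred nat} := [pred n | odd (offset n)].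

(* Main.v *)
Require Import Defs.
From mathcomp Require Import all_boot all_order all_algebra.
From mathcomp Require Import zify.

(** Column 1 of the Redheffer matrix has [n] unit entries, and the other columns
    have one for each pair [(r, s)] with [r] dividing [s] and [s > 1].
    Row [r] contains [n %/ r] multiples of [r], and [(1, 1)] is the only
    divisibility pair in column 1, whence
      [U n + 1 = n + \sum_(1 <= r <= n) n %/ r]
    ([redheffer_unit_count]). The sum counts the lattice points [(r, q)] with
    [r, q >= 1] below the hyperbola [r * q = n]. This region is symmetric under
    exchanging [r] and [q], so modulo 2 only its diagonal points matter
    ([odd_sum_symmetric]); they are the [r] with [r ^ 2 <= n], and there are
    [Nat.sqrt n] of them. Hence [U n + 1] has the parity of [n + Nat.sqrt n],
    which is also the parity of the offset [n - Nat.sqrt n ^ 2]. *)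

Lemma sum_ord_ltn n a : \sum_(i < n) (i < a) = minn n a.
Proof.
elim: n => [|n IHn]; first by rewrite big_ord0 min0n.
rewrite big_ord_recr /= IHn; lia.
Qed.

(** Off-diagonal terms cancel in pairs modulo 2. *)
Lemma odd_sum_symmetric (F : nat -> nat -> nat) n :
  (forall i j, F i j = F j i) ->
  odd (\sum_(i < n) \sum_(j < n) F i j) = odd (\sum_(i < n) F i i).
Proof.
move=> symF; elim: n => [|n IHn]; first by rewrite !big_ord0.
rewrite !big_ord_recr /=.
under eq_bigr => i _ do rewrite big_ord_recr /=.
rewrite big_split /= !oddD -IHn.
have -> : \sum_(i < n) F n i = \sum_(i < n) F i n by apply: eq_bigr.
by rewrite addbA addbK.
Qed.

Lemma divn_count_mul n d : 0 < d -> n %/ d = \sum_(q < n) (d * q.+1 <= n).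
Proof.
move=> d_gt0; rewrite (eq_bigr (fun q : 'I_n => (q < n %/ d) : nat)).
  by rewrite sum_ord_ltn; apply/esym/minn_idPr/leq_div.
by move=> q _; rewrite leq_divRL // mulnC.
Qed.

Lemma leq_sqr_sqrt m n : (m * m <= n) = (m <= Nat.sqrt n).
Proof.
have [lo hi] := PeanoNat.Nat.sqrt_spec n (PeanoNat.Nat.le_0_l n).
nia.
Qed.

Lemma odd_sum_divn n : odd (\sum_(r < n) n %/ r.+1) = odd (Nat.sqrt n).
Proof.
under eq_bigr => r _ do rewrite divn_count_mul //.
rewrite (odd_sum_symmetric (fun r q => r.+1 * q.+1 <= n)) => [|r q]; last first.
  by rewrite mulnC.
under eq_bigr => r _ do rewrite leq_sqr_sqrt.
rewrite sum_ord_ltn; congr (odd _); apply/minn_idPr.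
have := leq_sqr_sqrt (Nat.sqrt n) n; nia.
Qed.

Lemma U_sum n :
  U n = \sum_(r < n) \sum_(s < n) ((s.+1 == 1) || (r.+1 %| s.+1)).
Proof.
rewrite /U -sum1_card big_mkcond pair_big /=.
by apply: eq_bigr => -[r s] _; rewrite inE mxE /=; case: (_ || _).
Qed.

(** The correction on the left accounts for the entry [(1, 1)], which is a unit
    both as an entry of column 1 and as a divisibility pair; in the other rows
    column 1 contributes one entry beyond the [n.+1 %/ r.+1] multiples. *)
Lemma redheffer_row_count n r :
  \sum_(s < n.+1) ((s.+1 == 1) || (r.+1 %| s.+1)) + (r == 0)
    = 1 + n.+1 %/ r.+1.
Proof.
rewrite divn_count_dvd big_add1 big_mkord !big_ord_recl /=.
by rewrite dvdn1 eqSS addnAC -addnA.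
Qed.

Lemma redheffer_unit_count n :
  0 < n -> U n + 1 = n + \sum_(r < n) n %/ r.+1.
Proof.
case: n => // n _.
have <- : \sum_(r < n.+1) (r == 0 :> nat) = 1.
  by rewrite big_ord_recl /= big1.
rewrite U_sum -big_split /=.
under eq_bigr => r _ do rewrite redheffer_row_count.
by rewrite big_split /= sum1_card card_ord.
Qed.

Lemma odd_offset n : odd (offset n) = odd n (+) odd (Nat.sqrt n).
Proof. by rewrite /offset oddB ?oddX // -mulnn leq_sqr_sqrt. Qed.

Theorem lemma10p1 (n : nat) (n_ge1 : 1 <= n) :
  (odd (U n) <-> n \in calJ) /\ (~~ odd (U n) <-> n \in calK).
Proof.
have odd_U : odd (U n) = ~~ odd (offset n).
  rewrite odd_offset -(odd_sum_divn n) -oddD -redheffer_unit_count //.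
  by rewrite oddD addbT negbK.
by rewrite !inE odd_U negbK.
Qed.
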